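(* Let $\mathbf x=(x_1,\ldots,x_7)\in\mathbb C^7$. Then $\mathbf x\in \Gamma_{E(3;3;1,1,1)}$ if and only if (1) holds; likewise if and only if (2) holds; likewise if and only if (3) holds, where: (1) $(x_2,x_4,x_6)\in \Gamma_{E(2;2;1,1)}$ and $\|\Psi^{(1)}(\cdot,\mathbf x)\|_{H^\infty(\mathbb D^2)}\le1$, and, if $x_7=x_6x_1$, $x_3=x_2x_1$, $x_5=x_4x_1$, then $|x_1|\le1$; (2) $(x_1,x_4,x_5)\in \Gamma_{E(2;2;1,1)}$ and $\|\Psi^{(2)}(\cdot,\mathbf x)\|_{H^\infty(\mathbb D^2)}\le1$, and, if $x_7=x_5x_2$, $x_3=x_2x_1$, $x_6=x_4x_2$, then $|x_2|\le1$; (3) $(x_1,x_2,x_3)\in \Gamma_{E(2;2;1,1)}$ and $\|\Psi^{(3)}(\cdot,\mathbf x)\|_{H^\infty(\mathbb D^2)}\le1$, and, if $x_7=x_3x_4$, $x_6=x_2x_4$, $x_5=x_4x_1$, then $|x_4|\le1$.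
   Context: $\mathbb D$ is the open unit disc. For a linear subspace $E$ of $\mathcal M_{n\times n}(\mathbb C)$, $\mu_E(A)=1/\inf\{\|X\|: X\in E,\ \det(I-AX)=0\}$, with $\mu_E(A)=0$ if $I-AX$ is nonsingular for all $X\in E$ (operator norm). $E(2;2;1,1)$ is the space of $2\times2$ diagonal matrices and $E(3;3;1,1,1)$ the space of $3\times 3$ diagonal matrices. $\Gamma_{E(2;2;1,1)}=\{(a_{11},a_{22},\det A): A\in\mathcal M_{2\times2}(\mathbb C),\ \mu_{E(2;2;1,1)}(A)\le1\}$ (the closed tetrablock). $\Gamma_{E(3;3;1,1,1)}=\{\pi(A): A\in\mathcal M_{3\times3}(\mathbb C),\ \mu_{E(3;3;1,1,1)}(A)\le1\}$ where $$\pi(A)=\big(a_{11},\ a_{22},\ a_{11}a_{22}-a_{12}a_{21},\ a_{33},\ a_{11}a_{33}-a_{13}a_{31},\ a_{22}a_{33}-a_{23}a_{32},\ \det A\big).$$ The rational functions are $$\Psi^{(1)}(z_2,z_3,\mathbf x)=\frac{x_1-x_3z_2-x_5z_3+x_7z_2z_3}{1-x_2z_2-x_4z_3+x_6z_2z_3},\quad \Psi^{(2)}(z_1,z_3,\mathbf x)=\frac{x_2-x_3z_1-x_6z_3+x_7z_1z_3}{1-x_1z_1-x_4z_3+x_5z_1z_3},$$ $$\Psi^{(3)}(z_1,z_2,\mathbf x)=\frac{x_4-x_5z_1-x_6z_2+x_7z_1z_2}{1-x_1z_1-x_2z_2+x_3z_1z_2}.$$ $\|\cdot\|_{H^\infty(\mathbb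 D^2)}$ is the supremum of the modulus over $\mathbb D^2$; in each of (1), (2), (3) the closed tetrablock condition guarantees that the denominator has no zero on $\mathbb D^2$. *)

(* Defs.v *)
From HB Require Import structures.
From mathcomp Require Import all_boot all_order all_algebra.
From mathcomp Require Import all_classical all_reals all_analysis.
From mathcomp Require Import complex.

Set Implicit Arguments.
Unset Strict Implicit.
Unset Printing Implicit Defensive.

Import Order.TTheory GRing.Theory Num.Theory.
Local Open Scope classical_set_scope.
Local Open Scope ring_scope.
Local Open Scope complex_scope.

(* The complex field is R[i] for R : realType. Its native norm `|z| lives in
   R[i]; suprema and infima need the R-valued modulus. *)
Definition modulus (R : realType) (z : R[i]) : R := complex.Re `|z|.

Definition unit_disc (R : realType) : set R[i] := [set z | modulus z < 1].

Definition euclidean_norm (R : realType) (n : nat) (v : 'cV[R[i]]_n) : R :=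
  Num.sqrt (\sum_(i < n) modulus (v i 0) ^+ 2).

Definition operator_norm (R : realType) (n : nat) (A : 'M[R[i]]_n) : R :=
  sup [set euclidean_norm (A *m v) | v in [set v | euclidean_norm v <= 1]].

Definition mu_E (R : realType) (n : nat) (E : {vspace 'M[R[i]]_n})
    (A : 'M[R[i]]_n) : R :=
  let S := [set X : 'M[R[i]]_n | X \in E /\ \det (1%:M - A *m X) = 0] in
  if pselect (S = set0) then 0 else 1 / inf [set operator_norm X | X in S].

Definition diagonal_space (R : realType) (n : nat) : {vspace 'M[R[i]]_n} :=
  limg (linfun (@diag_mx R[i] n)).

Lemma diagonal_spaceE (R : realType) (n : nat) (X : 'M[R[i]]_n) :
  (X \in diagonal_space R n) = is_diag_mx X.
Proof.
apply/memv_imgP/diag_mxP => [[d _ ->]|[d ->]]; exists d; rewrite ?lfunE//.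
exact: memvf.
Qed.

Definition E_2_2_11 (R : realType) : {vspace 'M[R[i]]_2} := diagonal_space R 2.

Definition E_3_3_111 (R : realType) : {vspace 'M[R[i]]_3} := diagonal_space R 3.

Definition tuple_vec (R : realType) (n : nat) (s : n.-tuple R[i]) : 'rV[R[i]]_n :=
  \row_(i < n) tnth s i.

(* Matrix indices start at 0 here: the entry a_11 is A 0 0. *)
Definition tetra_map (R : realType) (A : 'M[R[i]]_2) : 'rV[R[i]]_3 :=
  tuple_vec [tuple A 0 0; A 1 1; \det A].

Definition Gamma_E_2_2_11 (R : realType) : set 'rV[R[i]]_3 :=
  [set tetra_map A | A in [set A | mu_E (E_2_2_11 R) A <= 1]].

Definition pi_map (R : realType) (A : 'M[R[i]]_3) : 'rV[R[i]]_7 :=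
  tuple_vec [tuple A 0 0;
                    A 1 1;
                    A 0 0 * A 1 1 - A 0 1 * A 1 0;
                    A 2 2;
                    A 0 0 * A 2 2 - A 0 2 * A 2 0;
                    A 1 1 * A 2 2 - A 1 2 * A 2 1;
                    \det A].

Definition Gamma_E_3_3_111 (R : realType) : set 'rV[R[i]]_7 :=
  [set pi_map A | A in [set A | mu_E (E_3_3_111 R) A <= 1]].

(* Division by 0 yields 0, so Psi1, Psi2 and Psi3 represent the rational
   functions only where the denominators do not vanish. *)
Definition Psi1 (R : realType) (x1 x2 x3 x4 x5 x6 x7 z2 z3 : R[i]) : R[i] :=
  (x1 - x3 * z2 - x5 * z3 + x7 * z2 * z3) /
  (1 - x2 * z2 - x4 * z3 + x6 * z2 * z3).

Definition Psi2 (R : realType) (x1 x2 x3 x4 x5 x6 x7 z1 z3 : R[i]) : R[i] :=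
  (x2 - x3 * z1 - x6 * z3 + x7 * z1 * z3) /
  (1 - x1 * z1 - x4 * z3 + x5 * z1 * z3).

Definition Psi3 (R : realType) (x1 x2 x3 x4 x5 x6 x7 z1 z2 : R[i]) : R[i] :=
  (x4 - x5 * z1 - x6 * z2 + x7 * z1 * z2) /
  (1 - x1 * z1 - x2 * z2 + x3 * z1 * z2).

Definition Hinfty_norm (R : realType) (f : R[i] -> R[i] -> R[i]) : \bar R :=
  ereal_sup [set (modulus (f z.1 z.2))%:E
            | z in @unit_disc R `*` @unit_disc R].

(* Main.v *)
Require Import Defs.
From HB Require Import structures.
From mathcomp Require Import all_boot all_order all_algebra.
From mathcomp Require Import all_classical all_reals all_analysis.
From mathcomp Require Import complex.
From mathcomp Require Import ring.

Set Implicit Arguments.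
Unset Strict Implicit.
Unset Printing Implicit Defensive.

Import Order.TTheory GRing.Theory Num.Theory.
Local Open Scope classical_set_scope.
Local Open Scope ring_scope.
Local Open Scope complex_scope.

(* For the diagonal spaces, mu_E(A) <= 1 says that det(I - A diag(z)) has no
   zero on the open polydisc. For n = 3 this determinant is
     1 - x1 z1 - x2 z2 + x3 z1 z2 - x4 z3 + x5 z1 z3 + x6 z2 z3 - x7 z1 z2 z3
   with x = pi(A), and every x in C^7 is some pi(A), so membership of x is the
   nonvanishing of this polynomial on D^3. In each variable z_k it has the form
   D - z_k N with Psi^(k) = N / D, and it does not vanish iff D has no zero on
   D^2 (the tetrablock condition) and |N / D| <= 1 there. *)

(** * The real-valued modulus *)

Lemma modulusE (R : realType) (z : R[i]) : (modulus z)%:C = `|z|.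
Proof. by rewrite /modulus normc_def. Qed.

Lemma modulus_ge0 (R : realType) (z : R[i]) : 0 <= modulus z.
Proof. by rewrite -lecR modulusE normr_ge0. Qed.

Lemma modulus_gt0 (R : realType) (z : R[i]) : (0 < modulus z) = (z != 0).
Proof. by rewrite -ltcR modulusE normr_gt0. Qed.

Lemma modulus0 (R : realType) : modulus (0 : R[i]) = 0.
Proof. by apply: complexI; rewrite modulusE normr0. Qed.

Lemma modulus1 (R : realType) : modulus (1 : R[i]) = 1.
Proof. by apply: complexI; rewrite modulusE normr1. Qed.

Lemma modulusM (R : realType) (z w : R[i]) :
  modulus (z * w) = modulus z * modulus w.
Proof. by apply: complexI; rewrite rmorphM /= !modulusE normrM. Qed.

Lemma modulusV (R : realType) (z : R[i]) : modulus z^-1 = (modulus z)^-1.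
Proof. by apply: complexI; rewrite fmorphV /= !modulusE normfV. Qed.

Lemma modulus_sum (R : realType) (I : Type) (r : seq I) (F : I -> R[i]) :
  modulus (\sum_(i <- r) F i) <= \sum_(i <- r) modulus (F i).
Proof.
rewrite -lecR modulusE rmorph_sum.
by rewrite [X in _ <= X](eq_bigr (fun i => `|F i|)) ?ler_norm_sum.
Qed.

(** * Operator norms of diagonal matrices and the condition mu_E(A) <= 1 *)

Lemma euclidean_norm0 (R : realType) n : euclidean_norm (0 : 'cV[R[i]]_n) = 0.
Proof.
rewrite /euclidean_norm big1 ?sqrtr0// => i _.
by rewrite mxE modulus0 expr0n.
Qed.

Lemma euclidean_norm_delta (R : realType) n (c : R[i]) (i : 'I_n) :
  euclidean_norm (c *: delta_mx i 0 : 'cV_n) = modulus c.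
Proof.
rewrite /euclidean_norm (bigD1 i)//= big1 => [|j ji].
  by rewrite addr0 !mxE !eqxx mulr1 sqrtr_sqr ger0_norm ?modulus_ge0.
by rewrite !mxE (negPf ji) mulr0 modulus0 expr0n.
Qed.

Lemma euclidean_norm_diag (R : realType) n (d : 'rV[R[i]]_n) (v : 'cV_n) (M : R) :
  0 <= M -> (forall i, modulus (d 0 i) <= M) ->
  euclidean_norm (diag_mx d *m v) <= M * euclidean_norm v.
Proof.
move=> M0 dM; rewrite -[M in M * _]ger0_norm// -sqrtr_sqr -sqrtrM ?sqr_ge0//.
rewrite ler_sqrt ?mulr_ge0 ?sqr_ge0 ?sumr_ge0// => [|i _]; last exact: sqr_ge0.
rewrite mulr_sumr ler_sum// => i _.
rewrite mul_diag_mx mxE modulusM exprMn ler_wpM2r ?sqr_ge0//.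
by rewrite lerXn2r ?nnegrE ?modulus_ge0.
Qed.

Lemma operator_norm_diag_le (R : realType) n (d : 'rV[R[i]]_n) (M : R) :
  0 <= M -> (forall i, modulus (d 0 i) <= M) -> operator_norm (diag_mx d) <= M.
Proof.
move=> M0 dM; apply: ge_sup.
  by exists (euclidean_norm (diag_mx d *m 0)), 0; rewrite //= euclidean_norm0.
move=> _ [v /= v1 <-]; apply: le_trans (euclidean_norm_diag v M0 dM) _.
by rewrite ler_piMr.
Qed.

(** The i-th basis vector attains |d_i|. With [operator_norm_diag_le], the operator norm of a
    diagonal matrix is the largest modulus on its diagonal. *)
Lemma operator_norm_diag_ge (R : realType) n (d : 'rV[R[i]]_n) (i : 'I_n) :
  modulus (d 0 i) <= operator_norm (diag_mx d).
Proof.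
apply: ub_le_sup.
  (* A crude upper bound: the supremum only dominates its elements once the set is known to be
     bounded. *)
  exists (\sum_j modulus (d 0 j)) => _ [v /= v1 <-].
  have s0 : 0 <= \sum_j modulus (d 0 j).
    by apply: sumr_ge0 => j _; exact: modulus_ge0.
  apply: le_trans (euclidean_norm_diag v s0 _) _; last by rewrite ler_piMr.
  move=> j; rewrite (bigD1 j)//= lerDl sumr_ge0// => k _; exact: modulus_ge0.
exists (delta_mx i 0) => /=.
  by rewrite -[delta_mx _ _]scale1r euclidean_norm_delta modulus1.
rewrite -(euclidean_norm_delta (d 0 i) i); congr euclidean_norm.
apply/matrixP => j k; rewrite mul_diag_mx !mxE.
by have [->|] := eqVneq j i; rewrite ?andFb ?mulr0.
Qed.

(* A left kernel vector v of I - AX satisfies v_j = (v A)_j x_j; comparing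
   moduli at the largest coordinate of v bounds some |x_j| from below. This
   keeps the infimum defining mu_E positive, where 1 / 0 = 0 would otherwise
   make mu_E(A) <= 1 hold vacuously. *)
Lemma singular_diag_lower_bound (R : realType) n (A : 'M[R[i]]_n) :
  exists2 c : R, 0 < c & forall d : 'rV_n,
    \det (1%:M - A *m diag_mx d) = 0 -> c <= operator_norm (diag_mx d).
Proof.
(* s dominates every column sum of moduli of A, and the summand 1 keeps it positive; the bound is c
   = 1/s. *)
pose s := 1 + \sum_j \sum_i modulus (A i j).
have sum_ge0 j : 0 <= \sum_i modulus (A i j).
  by apply: sumr_ge0 => i _; exact: modulus_ge0.
have s_gt0 : 0 < s by rewrite ltr_pwDl// sumr_ge0.
exists s^-1; first by rewrite invr_gt0.
move=> d /eqP/det0P[v v0]; rewrite mulmxBr mulmx1 => /eqP.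
rewrite subr_eq0 mulmxA mul_mx_diag => /eqP/matrixP vE.
have [i0 vi0] : exists i, v 0 i != 0.
  apply/existsP; apply: contraNT v0; rewrite negb_exists => /forallP v0.
  by apply/eqP/rowP => i; rewrite mxE; apply/eqP; rewrite -[_ == _]negbK.
case: (@arg_maxP _ R _ i0 xpredT (fun i => modulus (v 0 i)) isT) => j _ vj.
have vj_gt0 : 0 < modulus (v 0 j).
  by apply: lt_le_trans (vj i0 isT); rewrite modulus_gt0.
apply: le_trans (operator_norm_diag_ge d j); rewrite -div1r ler_pdivrMr//.
rewrite -(ler_pM2l vj_gt0) mulr1 {1}vE !mxE modulusM mulrA mulrAC.
rewrite ler_wpM2r ?modulus_ge0//.
apply: le_trans (modulus_sum _ _) _.
apply: (@le_trans _ _ (\sum_i modulus (v 0 j) * modulus (A i j))).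
  apply: ler_sum => i _; rewrite modulusM ler_wpM2r ?modulus_ge0//; exact: vj.
rewrite -mulr_sumr ler_wpM2l ?modulus_ge0// /s [X in _ <= 1 + X](bigD1 j)//= addrCA lerDl.
by rewrite addr_ge0 ?sumr_ge0.
Qed.

(** Since the norm of diag(d) is max |d_i|, the open unit ball of the diagonal space is the open
    polydisc, and mu_E(A) <= 1 says that no singularity occurs inside it. *)
Lemma mu_diagonal_le1 (R : realType) n (A : 'M[R[i]]_n) :
  mu_E (diagonal_space R n) A <= 1 <->
  forall d : 'rV_n, (forall i, modulus (d 0 i) < 1) ->
    \det (1%:M - A *m diag_mx d) != 0.
Proof.
rewrite /mu_E /=; set S := [set X | _].
have SE d : S (diag_mx d) <-> \det (1%:M - A *m diag_mx d) = 0.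
  by split=> [[]//|?]; split=> //; rewrite diagonal_spaceE diag_mx_is_diag.
have Sdiag X : S X -> exists d, X = diag_mx d.
  by move=> [+ _]; rewrite diagonal_spaceE => /diag_mxP.
have [c c0 Sc] := singular_diag_lower_bound A.
have Slb : lbound [set operator_norm X | X in S] c.
  by move=> _ [X XS <-]; have [d Xd] := Sdiag X XS; subst X; apply/Sc/SE.
(* If [S] is empty, mu_E(A) is 0 by convention and no determinant vanishes, so both sides hold. *)
case: pselect => [S0|S0].
  by split=> // _ d _; apply/eqP => /SE; rewrite S0.
have /set0P[X0 SX0] : S != set0 by apply/eqP.
have S_neq0 : [set operator_norm X | X in S] !=set0.
  by exists (operator_norm X0), X0.
have inf_gt0 : 0 < inf [set operator_norm X | X in S].
  by apply: lt_le_trans c0 _; exact: lb_le_inf.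
rewrite ler_pdivrMr// mul1r; split=> [inf_ge1 d d1|detN0].
  apply/eqP => /SE Sd.
  (* A maximum of finitely many moduli below 1 is still strictly below 1, which contradicts an
     infimum of at least 1. *)
  have [M [M0 M1 dM]] : exists M : R,
      [/\ 0 <= M, M < 1 & forall i, modulus (d 0 i) <= M].
    exists (\big[Num.max/0]_i modulus (d 0 i)); split.
    - by apply/bigmax_geP; left.
    - by apply/bigmax_ltP; split.
    - by move=> i; apply: le_bigmax_cond.
  have: inf [set operator_norm X | X in S] <= M.
    apply: le_trans (operator_norm_diag_le M0 dM).
    by apply: ge_inf; [exists c | exists (diag_mx d)].
  by rewrite leNgt (lt_le_trans M1).
apply: lb_le_inf => // _ [X SX <-]; have [d Xd] := Sdiag X SX; subst X.
have [d1|/existsNP[i /negP]] := pselect (forall i, modulus (d 0 i) < 1).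
  by have /SE/eqP := SX; rewrite (negPf (detN0 d d1)).
rewrite -leNgt => di_ge1.
exact: le_trans di_ge1 (operator_norm_diag_ge d i).
Qed.

(** * Both Gamma sets as nonvanishing conditions on polynomials *)

Lemma det_mx22E (T : comPzRingType) (A : 'M[T]_2) :
  \det A = A 0 0 * A 1 1 - A 0 1 * A 1 0.
Proof.
(* Indexing by naturals lets different presentations of the same ordinal compute to one index, so
   that [ring] identifies the entries. *)
pose a (i j : nat) := A (inord i) (inord j).
have aE i j : A i j = a i j by rewrite /a !inord_val.
rewrite (expand_det_row _ ord0) big_ord_recl big_ord1 /cofactor !det_mx11.
by rewrite !mxE !aE /= /bump /= expr0 expr1; ring.
Qed.

Lemma det_mx33E (T : comPzRingType) (A : 'M[T]_3) :
  \det A = A 0 0 * A 1 1 * A 2 2 + A 0 1 * A 1 2 * A 2 0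
         + A 0 2 * A 1 0 * A 2 1 - A 0 0 * A 1 2 * A 2 1
         - A 0 1 * A 1 0 * A 2 2 - A 0 2 * A 1 1 * A 2 0.
Proof.
pose a (i j : nat) := A (inord i) (inord j).
have aE i j : A i j = a i j by rewrite /a !inord_val.
rewrite (expand_det_row _ ord0) !big_ord_recl big_ord0 /cofactor !det_mx22E.
rewrite !mxE !aE /= /bump /=.
by ring.
Qed.

Lemma eq_tuple_vec (R : realType) n (s t : n.-tuple R[i]) :
  tuple_vec s = tuple_vec t -> s = t.
Proof.
by move=> /rowP st; apply/eq_from_tnth => i; have := st i; rewrite !mxE.
Qed.

Lemma Gamma_E_2_2_11P (R : realType) (a b c : R[i]) :
  Gamma_E_2_2_11 (tuple_vec [tuple a; b; c]) <->
  forall z w, modulus z < 1 -> modulus w < 1 -> 1 - a * z - b * w + c * z * w != 0.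
Proof.
have detE (A : 'M[R[i]]_2) (d : 'rV_2) : \det (1%:M - A *m diag_mx d) =
    1 - A 0 0 * d 0 0 - A 1 1 * d 0 1 + \det A * d 0 0 * d 0 1.
  by rewrite mul_mx_diag !det_mx22E !mxE /=; ring.
split=> [[A /mu_diagonal_le1 mu1 /eq_tuple_vec[<- <- <-]] z w z1 w1|nz].
  have := mu1 (tuple_vec [tuple z; w]); rewrite detE !mxE; apply.
  by case=> [[|[|//]]] /= ?; rewrite mxE.
(* Determinant c forces the off-diagonal product to be a b - c; one factor is taken to be 1. *)
pose A : 'M[R[i]]_2 := \matrix_(i, j)
  nth 0 (nth [::] [:: [:: a; a * b - c]; [:: 1; b]] i) j.
exists A.
  apply/mu_diagonal_le1 => d d1; rewrite detE.
  have -> : \det A = c by rewrite det_mx22E !mxE /=; ring.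
  by rewrite !mxE /=; exact: nz.
by rewrite /tetra_map det_mx22E !mxE /=; congr (tuple_vec [tuple _; _; _]); ring.
Qed.

(** u and v are the roots of T^2 - s T + m, given by the quadratic formula. *)
Lemma sum_product_roots (F : numClosedFieldType) (s m : F) :
  exists u v, u + v = s /\ u * v = m.
Proof.
pose r := sqrtC (s ^+ 2 - m *+ 4).
exists ((s + r) / 2), ((s - r) / 2); split; first by field.
have rr : r * r = s ^+ 2 - m *+ 4 by rewrite -expr2 sqrtCK.
have -> : (s + r) / 2 * ((s - r) / 2) = (s ^+ 2 - r * r) / 4 by field.
by rewrite rr; field.
Qed.

(* The off-diagonal entries only enter through p, q, r and the two 3-cycle
   products, whose sum is prescribed by the determinant and whose product is
   p q r. *)
Lemma three_cycles (F : numClosedFieldType) (p q r s : F) :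
  exists a12 a13 a21 a23 a31 a32 : F,
    [/\ a12 * a21 = p, a13 * a31 = q, a23 * a32 = r &
        a12 * a23 * a31 + a13 * a21 * a32 = s].
Proof.
(* When p, q or r vanishes, so may one of the two 3-cycle products; the other is then set to s. *)
have [->|p0] := eqVneq p 0.
  by exists s, q, 0, 1, 1, r; split; ring.
have [->|q0] := eqVneq q 0.
  by exists 1, 0, p, 1, s, r; split; ring.
have [->|r0] := eqVneq r 0.
  by exists 1, q, p, s, 1, 0; split; ring.
(* In the remaining case the 3-cycle products are u and v; u v = p q r is nonzero, so division by u
   is legitimate. *)
have [u [v [uvs uvm]]] := sum_product_roots s (p * q * r).
have u0 : u != 0.
  by apply: contra_neq (mulf_neq0 (mulf_neq0 p0 q0) r0) => u0; rewrite -uvm u0 mul0r.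
exists 1, (q / u), p, 1, u, r; split; [by ring|by field|by ring|].
have -> : q / u * p * r = v by rewrite -[v](mulKf u0) uvm; field.
by rewrite !mul1r.
Qed.

Lemma Gamma_E_3_3_111P (R : realType) (x1 x2 x3 x4 x5 x6 x7 : R[i]) :
  Gamma_E_3_3_111 (tuple_vec [tuple x1; x2; x3; x4; x5; x6; x7]) <->
  forall z1 z2 z3, modulus z1 < 1 -> modulus z2 < 1 -> modulus z3 < 1 ->
    1 - x1 * z1 - x2 * z2 + x3 * z1 * z2 - x4 * z3 + x5 * z1 * z3
      + x6 * z2 * z3 - x7 * z1 * z2 * z3 != 0.
Proof.
have detE (A : 'M[R[i]]_3) (d : 'rV_3) : \det (1%:M - A *m diag_mx d) =
    1 - A 0 0 * d 0 0 - A 1 1 * d 0 1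
    + (A 0 0 * A 1 1 - A 0 1 * A 1 0) * d 0 0 * d 0 1 - A 2 2 * d 0 2
    + (A 0 0 * A 2 2 - A 0 2 * A 2 0) * d 0 0 * d 0 2
    + (A 1 1 * A 2 2 - A 1 2 * A 2 1) * d 0 1 * d 0 2
    - \det A * d 0 0 * d 0 1 * d 0 2.
  by rewrite mul_mx_diag !det_mx33E !mxE /=; ring.
split=> [[A /mu_diagonal_le1 mu1 /eq_tuple_vec]|nz].
  move=> [<- <- <- <- <- <- <-] z1 z2 z3 z11 z21 z31.
  have := mu1 (tuple_vec [tuple z1; z2; z3]); rewrite detE !mxE; apply.
  by case=> [[|[|[|//]]]] /= ?; rewrite mxE.
(* The 2x2 principal minors prescribe the three products. The last argument solves x7 = x1 x2 x4 + s
   - x1 r - x2 q - x4 p for the sum s of the 3-cycle products. *)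
have [a12 [a13 [a21 [a23 [a31 [a32 [pE qE rE sE]]]]]]] :=
  three_cycles (x1 * x2 - x3) (x1 * x4 - x5) (x2 * x4 - x6)
    (x7 - x1 * x2 * x4 + x1 * (x2 * x4 - x6) + x2 * (x1 * x4 - x5)
     + x4 * (x1 * x2 - x3)).
pose A : 'M[R[i]]_3 := \matrix_(i, j)
  nth 0 (nth [::] [:: [:: x1; a12; a13]; [:: a21; x2; a23]; [:: a31; a32; x4]] i) j.
have piE : pi_map A = tuple_vec [tuple x1; x2; x3; x4; x5; x6; x7].
  rewrite /pi_map det_mx33E !mxE /=.
  congr (tuple_vec [tuple _; _; _; _; _; _; _]).
  - by rewrite pE; ring.
  - by rewrite qE; ring.
  - by rewrite rE; ring.
  - transitivity (x1 * x2 * x4 + (a12 * a23 * a31 + a13 * a21 * a32)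
      - x1 * (a23 * a32) - x4 * (a12 * a21) - x2 * (a13 * a31)); first by ring.
    by rewrite sE pE qE rE; ring.
exists A => //; apply/mu_diagonal_le1 => d d1; rewrite detE.
by have /eq_tuple_vec[-> -> -> -> -> -> ->] := piE; exact: nz.
Qed.

(** * From nonvanishing to the supremum norm of the quotients *)

Lemma Hinfty_norm_le1 (R : realType) (f : R[i] -> R[i] -> R[i]) :
  (Hinfty_norm f <= 1%:E)%E <->
  forall z w, modulus z < 1 -> modulus w < 1 -> modulus (f z w) <= 1.
Proof.
split=> [f1 z w z1 w1|f1].
  rewrite -lee_fin; apply: le_trans f1.
  by apply: ereal_sup_ubound; exists (z, w).
by apply: ge_ereal_sup => _ [[z w] /= [z1 w1] <-]; rewrite lee_fin; exact: f1.
Qed.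

(* D - z N vanishes at some |z| < 1 exactly when D = 0 (take z = 0) or
   |N / D| > 1 (take z = D / N). *)
Lemma affine_nonvanishing (R : realType) (D N : R[i]) :
  (forall z, modulus z < 1 -> D - z * N != 0) <->
  D != 0 /\ modulus (N / D) <= 1.
Proof.
split=> [nz|[D0 ND1] z z1].
  have D0 : D != 0 by have := nz 0; rewrite modulus0 mul0r subr0; exact.
  split=> //; rewrite leNgt; apply/negP => ND1.
  have N0 : N != 0.
    by apply: contraTneq ND1 => ->; rewrite mul0r modulus0 ltr10.
  suff DN1 : modulus (D / N) < 1 by have := nz _ DN1; rewrite divfK// subrr eqxx.
  by rewrite -invf_div modulusV invf_lt1// (lt_trans ltr01).
apply/eqP => /eqP; rewrite subr_eq0 => /eqP DE.
have : modulus (z * (N / D)) = 1 by rewrite mulrA -DE divff// modulus1.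
apply/eqP; rewrite lt_eqF// modulusM.
by apply: le_lt_trans z1; rewrite ler_piMr ?modulus_ge0.
Qed.

Lemma nonvanishing_iff_Hinfty (R : realType) (D N : R[i] -> R[i] -> R[i]) :
  (forall u z w, modulus u < 1 -> modulus z < 1 -> modulus w < 1 ->
     D z w - u * N z w != 0) <->
  (forall z w, modulus z < 1 -> modulus w < 1 -> D z w != 0) /\
  (Hinfty_norm (fun z w => (N z w / D z w)%R) <= 1%:E)%E.
Proof.
rewrite Hinfty_norm_le1; split=> [nz|[D0 ND1] u z w u1 z1 w1].
  have nzP z w z1 w1 := (affine_nonvanishing (D z w) (N z w)).1
    (fun u u1 => nz u z w u1 z1 w1).
  by split=> z w z1 w1; have [] := nzP z w z1 w1.
by apply: (affine_nonvanishing _ _).2 => //; split; [exact: D0 | exact: ND1].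
Qed.

(* The clause on x is automatic: the value of the quotient at (0, 0) is x. *)
Lemma nonvanishing_iff_Psi (R : realType) (a b c x p q t : R[i]) (P : Prop) :
  (forall u z w, modulus u < 1 -> modulus z < 1 -> modulus w < 1 ->
     1 - a * z - b * w + c * z * w - u * (x - p * z - q * w + t * z * w) != 0) <->
  [/\ Gamma_E_2_2_11 (tuple_vec [tuple a; b; c]),
      (Hinfty_norm (fun z w => ((x - p * z - q * w + t * z * w) /
         (1 - a * z - b * w + c * z * w))%R) <= 1%:E)%E &
      (P -> modulus x <= 1)].
Proof.
rewrite (nonvanishing_iff_Hinfty (fun z w => 1 - a * z - b * w + c * z * w)
  (fun z w => x - p * z - q * w + t * z * w)) -Gamma_E_2_2_11P.
split=> [[Gabc H1]|[]//]; split=> // _.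
have /Hinfty_norm_le1/(_ 0 0) := H1.
by rewrite modulus0 ltr01 !mulr0 !subr0 !addr0 divr1; exact.
Qed.

Theorem theorem2p28 (R : realType) (x1 x2 x3 x4 x5 x6 x7 : R[i]) :
  (Gamma_E_3_3_111 (tuple_vec [tuple x1; x2; x3; x4; x5; x6; x7]) <->
     [/\ Gamma_E_2_2_11 (tuple_vec [tuple x2; x4; x6]),
         (Hinfty_norm (Psi1 x1 x2 x3 x4 x5 x6 x7) <= 1%:E)%E &
         (x7 = x6 * x1 /\ x3 = x2 * x1 /\ x5 = x4 * x1 -> modulus x1 <= 1)]) /\
  (Gamma_E_3_3_111 (tuple_vec [tuple x1; x2; x3; x4; x5; x6; x7]) <->
     [/\ Gamma_E_2_2_11 (tuple_vec [tuple x1; x4; x5]),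
         (Hinfty_norm (Psi2 x1 x2 x3 x4 x5 x6 x7) <= 1%:E)%E &
         (x7 = x5 * x2 /\ x3 = x2 * x1 /\ x6 = x4 * x2 -> modulus x2 <= 1)]) /\
  (Gamma_E_3_3_111 (tuple_vec [tuple x1; x2; x3; x4; x5; x6; x7]) <->
     [/\ Gamma_E_2_2_11 (tuple_vec [tuple x1; x2; x3]),
         (Hinfty_norm (Psi3 x1 x2 x3 x4 x5 x6 x7) <= 1%:E)%E &
         (x7 = x3 * x4 /\ x6 = x2 * x4 /\ x5 = x4 * x1 -> modulus x4 <= 1)]).
Proof.
(* All three conditions become nonvanishing of the same polynomial, with z1, z2 or z3 in turn as the
   distinguished variable; only the order of the variables remains to be matched. *)
rewrite -3!nonvanishing_iff_Psi Gamma_E_3_3_111P.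
split; [|split]; split=> nz u z w u1 z1 w1.
- by have := nz u z w u1 z1 w1; congr (_ != _); ring.
- by have := nz u z w u1 z1 w1; congr (_ != _); ring.
- by have := nz z u w z1 u1 w1; congr (_ != _); ring.
- by have := nz z u w z1 u1 w1; congr (_ != _); ring.
- by have := nz z w u z1 w1 u1; congr (_ != _); ring.
- by have := nz w u z w1 u1 z1; congr (_ != _); ring.
Qed.
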